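(* Let $A$ be the convolution matrix of $\mathbb{F}_2^n$, let $M_H$ be the adjacency matrix of the subspace hypergraph $\mathcal{H}_n$, let $f,g:\mathbb{F}_2^n\to\mathbb{C}$, and let $f',g'$ be the restrictions of $f,g$ to $\mathbb{F}_2^n\setminus\{\overline 0\}$. Then for every $x\ne\overline 0$ $$(A\cdot(f,g))(x)=2\,(M_H\cdot(f',g'))(x)+f(\overline 0)g(x)+f(x)g(\overline 0),$$ and $$(A\cdot(f,g))(\overline 0)=\sum_{x\in\mathbb{F}_2^n}f(x)g(x).$$
   Context: $\overline 0$ is the zero vector of $\mathbb{F}_2^n$. The convolution matrix $A=(a_{x,y,z})$ of $\mathbb{F}_2^n$ is indexed by $x,y,z\in\mathbb{F}_2^n$, with $a_{x,y,z}=1$ if $x=y+z$ and $0$ otherwise. The subspace hypergraph $\mathcal{H}_n$ is the $3$-uniform hypergraph with vertex set $\mathbb{F}_2^n\setminus\{\overline 0\}$ whose hyperedges are the $3$-element sets $\{x,y,z\}$ of vertices with $x+y+z=\overline 0$. The adjacency matrix $M_H=(m_{x,y,z})$ is indexed by triples of vertices, with $m_{x,y,z}=\frac12$ if $\{x,y,z\}$ is a hyperedge and $0$ otherwise. For a $3$-dimensional matrix $B=(b_{x,y,z})$ indexed by a finite set $X$ and functions $f_1,f_2:X\to\mathbb{C}$, the combined product is $(B\cdot(f_1,f_2))(x)=\sum_{y,z\in X}b_{x,y,z}f_1(y)f_2(z)$. *)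

(* Defs.v *)
From HB Require Import structures.
From mathcomp Require Import all_boot all_order all_algebra.
From mathcomp Require Import reals.
From mathcomp Require Import complex.
Set Implicit Arguments.
Unset Strict Implicit.
Unset Printing Implicit Defensive.
Import GRing.Theory.
Local Open Scope ring_scope.

Definition matrix3 (X : finType) (K : Type) := X -> X -> X -> K.

Definition combined_product (K : pzRingType) (X : finType) (B : matrix3 X K)
    (f1 f2 : X -> K) (x : X) : K :=
  \sum_(y : X) \sum_(z : X) B x y z * f1 y * f2 z.

Definition convolution_matrix (K : pzRingType) (n : nat) :
    matrix3 'rV['F_2]_n K :=
  fun x y z => if x == y + z then 1 else 0.

Record hypergraph3 (V : finType) := Hypergraph3 {
  hyperedges : {set {set V}};
  hyperedges_card : forall e : {set V}, e \in hyperedges -> #|e| = 3%N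
}.

(* The entry 1/2 is 1/(k-1)! at k = 3.  When x, y, z are not pairwise distinct,
   [set x; y; z] has fewer than 3 elements, hence is not a hyperedge. *)
Definition adjacency_matrix (K : unitRingType) (V : finType)
    (H : hypergraph3 V) : matrix3 V K :=
  fun x y z => if [set x; y; z] \in hyperedges H then 2^-1 else 0.

Definition nonzero_vector (n : nat) := {x : 'rV['F_2]_n | x != 0}.

Definition subspace_hyperedges (n : nat) : {set {set nonzero_vector n}} :=
  [set e : {set nonzero_vector n} | (#|e| == 3%N) && (\sum_(v in e) val v == 0)].

Lemma subspace_hyperedges_card (n : nat) (e : {set nonzero_vector n}) :
  e \in subspace_hyperedges n -> #|e| = 3%N.
Proof. by rewrite inE => /andP[/eqP]. Qed.

Definition subspace_hypergraph (n : nat) : hypergraph3 (nonzero_vector n) :=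
  Hypergraph3 (@subspace_hyperedges_card n).

Definition restrict_nonzero (K : Type) (n : nat) (f : 'rV['F_2]_n -> K) :
    nonzero_vector n -> K :=
  fun v => f (val v).

(* Main.v *)
Require Import Defs.
From HB Require Import structures.
From mathcomp Require Import all_boot all_order all_algebra.
From mathcomp Require Import reals.
From mathcomp Require Import complex.
Import GRing.Theory.
Local Open Scope ring_scope.

(** The non-zero vectors [x], [y], [z] form a hyperedge exactly when
    [x = y + z] (lemma [hyperedge_nonzeroE]): in characteristic 2 this equation
    is the symmetric condition [x + y + z = 0], and if two of the vectors were
    equal, the third would vanish.  Hence twice the adjacency matrix is the
    convolution matrix with the index [0] deleted, and
    [2 * (M_H . (f', g')) x] collects the terms of [(A . (f, g)) x] with [y] and
    [z] both non-zero.  For [x != 0] the deleted terms are [y = 0, z = x] and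
    [y = x, z = 0].  At [x = 0] the equation [0 = y + z] forces [z = y]. *)

Lemma addvv_F2 (n : nat) (x : 'rV['F_2]_n) : x + x = 0.
Proof.
have pcharF2 : (2 \in [pchar 'F_2])%N by exact: pchar_Fp.
by rewrite -mulr2n -scaler_nat pcharf0 // scale0r.
Qed.

Lemma oppv_F2 (n : nat) (x : 'rV['F_2]_n) : - x = x.
Proof. by apply/eqP; rewrite eq_sym -subr_eq0 opprK addvv_F2. Qed.

Lemma addv_eq0_F2 (n : nat) (x y : 'rV['F_2]_n) : (x + y == 0) = (x == y).
Proof. by rewrite addr_eq0 oppv_F2. Qed.

(** An equation [x = y + z] between non-zero vectors makes them pairwise
    distinct, so the cardinality condition on hyperedges is automatic. *)
Lemma hyperedge_nonzeroE (n : nat) (x y z : nonzero_vector n) :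
  ([set x; y; z] \in subspace_hyperedges n) = (val x == val y + val z).
Proof.
have sum3 : uniq [:: x; y; z] ->
    \sum_(v in [set x; y; z]) val v = val x + (val y + val z).
  move=> Uxyz; rewrite (eq_bigl (mem [:: x; y; z])); last first.
    by move=> v; rewrite !inE -orbA.
  by rewrite -big_uniq //= !big_cons big_nil addr0.
have card3 : (#|[set x; y; z]| == 3)%N = uniq [:: x; y; z].
  rewrite (@eq_card _ _ (mem [:: x; y; z])).
    by apply/eqP/card_uniqP.
  by move=> v; rewrite !inE -orbA.
rewrite inE card3; have [U|nU] /= := boolP (uniq [:: x; y; z]).
  by rewrite sum3 // addv_eq0_F2.
symmetry; apply: contraNF nU => /eqP def_x.
rewrite /= !inE !andbT negb_or -andbA; apply/and3P; split.
- rewrite -val_eqE -addv_eq0_F2 /= def_x addrAC addvv_F2 add0r; exact: (valP z).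
- rewrite -val_eqE -addv_eq0_F2 /= def_x -addrA addvv_F2 addr0; exact: (valP y).
- rewrite -val_eqE -addv_eq0_F2 /= -def_x; exact: (valP x).
Qed.

(** By [hyperedge_nonzeroE] the two matrices have the same support on non-zero
    indices, so they differ there only by the normalising factor [1/2]. *)
Lemma adjacency_matrixE (K : unitRingType) (n : nat) (x y z : nonzero_vector n) :
  (2 : K) \is a GRing.unit ->
  2 * adjacency_matrix K (subspace_hypergraph n) x y z =
    convolution_matrix K (val x) (val y) (val z).
Proof.
move=> unit2; rewrite /adjacency_matrix /convolution_matrix /= hyperedge_nonzeroE.
by case: ifP => _; rewrite ?divrr ?mulr0.
Qed.

Lemma big_nonzero_vector (V : nmodType) (n : nat) (F : 'rV['F_2]_n -> V) :
  \sum_(v : nonzero_vector n) F (val v) = \sum_(x | x != 0) F x.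
Proof. by rewrite [RHS](big_sub [pred x : 'rV['F_2]_n | x != 0]). Qed.

Lemma combined_product_adjacency (K : unitRingType) (n : nat)
    (f g : 'rV['F_2]_n -> K) (x : nonzero_vector n) :
  (2 : K) \is a GRing.unit ->
  2 * combined_product (adjacency_matrix K (subspace_hypergraph n))
        (restrict_nonzero f) (restrict_nonzero g) x =
    \sum_(y | y != 0) \sum_(z | z != 0)
      convolution_matrix K (val x) y z * f y * g z.
Proof.
move=> unit2; rewrite /combined_product mulr_sumr.
rewrite -big_nonzero_vector.
apply: eq_bigr => y _; rewrite mulr_sumr.
rewrite -big_nonzero_vector.
by apply: eq_bigr => z _; rewrite !mulrA adjacency_matrixE.
Qed.

(** In characteristic 2, [x = y + z] has the single solution [z = x + y]. *)
Lemma sum_convolution_row (K : pzRingType) (n : nat) (a : K)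
    (g : 'rV['F_2]_n -> K) (x y : 'rV['F_2]_n) :
  \sum_z convolution_matrix K x y z * a * g z = a * g (x + y).
Proof.
rewrite (bigD1 (x + y)) //= /convolution_matrix addrCA addvv_F2 addr0 eqxx mul1r.
rewrite big1 ?addr0 // => z z_neq; case: eqP => [def_x|_]; last by rewrite !mul0r.
by rewrite def_x addrAC addvv_F2 add0r eqxx in z_neq.
Qed.

(** For [x != 0] the summands with [y = 0] or [z = 0] that survive are the two
    distinct ones with [(y, z) = (0, x)] and [(y, z) = (x, 0)]. *)
Lemma combined_product_convolution_split (K : pzRingType) (n : nat)
    (f g : 'rV['F_2]_n -> K) (x : 'rV['F_2]_n) :
  x != 0 ->
  combined_product (@convolution_matrix K n) f g x =
    \sum_(y | y != 0) \sum_(z | z != 0)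
      convolution_matrix K x y z * f y * g z
    + f 0 * g x + f x * g 0.
Proof.
move=> x0; rewrite /combined_product (bigD1 0) //= sum_convolution_row addr0.
rewrite (eq_bigr _ (fun y _ => bigD1 (0 : 'rV['F_2]_n) _)) //= big_split /=.
have -> : \sum_(y | y != 0) convolution_matrix K x y 0 * f y * g 0 = f x * g 0.
  rewrite (bigD1 x) //= /convolution_matrix addr0 eqxx mul1r.
  rewrite big1 ?addr0 // => y /andP[_ yx].
  by rewrite addr0 eq_sym (negPf yx) !mul0r.
by rewrite [f x * _ + _]addrC addrA [f 0 * _ + _]addrC.
Qed.

Theorem proposition5 (R : realType) (n : nat) (f g : 'rV['F_2]_n -> R[i]) :
  (forall (x : 'rV['F_2]_n) (hx : x != 0),
     combined_product (@convolution_matrix R[i] n) f g x =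
       2 * combined_product (adjacency_matrix R[i] (subspace_hypergraph n))
             (restrict_nonzero f) (restrict_nonzero g) (exist _ x hx)
       + f 0 * g x + f x * g 0)
  /\
  combined_product (@convolution_matrix R[i] n) f g 0 =
    \sum_(x : 'rV['F_2]_n) f x * g x.
Proof.
split=> [x hx|].
  rewrite combined_product_adjacency; first exact: combined_product_convolution_split.
  by rewrite unitfE Num.Theory.pnatr_eq0.
by apply: eq_bigr => x _; rewrite sum_convolution_row add0r.
Qed.
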